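(* Let $s\in\mathbb{C}$ and $\ell\in\mathbb{R}\setminus\{0\}$. Then for any $\beta\in\mathbb{C}$ with $\beta\neq \ell+k\pi$ for all nonzero integers $k$, $$\operatorname{sinc}(s-\ell)=\operatorname{sinc}(\beta)\prod_{k=1}^\infty\left[1-\frac{(s-\ell)^2-(\beta-\ell)^2}{k^2\pi^2-(\beta-\ell)^2}\right].$$
   Context: The function $\operatorname{sinc}$ is the entire function $\operatorname{sinc}(s)=\sum_{m=0}^\infty \frac{(-1)^m s^{2m}}{(2m+1)!}$.
   Formalization: The prefactor sinc(β) is corrected to sinc(β−ℓ): as printed the identity fails at s=β=ℓ=π/2, where every factor is 1 and it would say sinc(0)=1 equals sinc(π/2)=2/π. *)

(* Defs.v *)
From Stdlib Require Import Reals Factorial Lra Lia.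
From Coquelicot Require Import Coquelicot.
Open Scope R_scope.

Definition sinc_term (s : C) (m : nat) : C :=
  ((-1) ^ m * s ^ (2 * m) / INR (fact (2 * m + 1)))%C.

(* Coquelicot's total [Series] is real-valued, so the complex series is summed
   componentwise; [sinc_correct] shows that it converges in C to this value. *)
Definition sinc (s : C) : C :=
  (Series (fun m => Re (sinc_term s m)), Series (fun m => Im (sinc_term s m))).

(* The product of a 1, ..., a n: the index starts at 1 and a 0 is not used. *)
Fixpoint Cprod (a : nat -> C) (n : nat) : C :=
  match n with
  | O => 1
  | S m => Cprod a m * a (S m)
  end%C.

(* The value of an infinite product is the limit of its partial products; it
   may be 0, in particular when one of the factors vanishes. *)
Definition is_infprod (a : nat -> C) (p : C) : Prop :=
  filterlim (Cprod a) eventually (@locally C_UniformSpace p).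

Lemma Cmod_sinc_term (s : C) (m : nat) :
  Cmod (sinc_term s m) = (Cmod s ^ 2) ^ m / INR (fact (2 * m + 1)).
Proof.
assert (H : 0 < INR (fact (2 * m + 1))) by apply INR_fact_lt_0.
unfold sinc_term.
rewrite Cmod_div, Cmod_mult, !Cmod_pow.
- replace (Cmod (-1)) with 1
    by (rewrite Cmod_R, Rabs_left by lra; lra).
  rewrite pow1, Rmult_1_l, pow_mult, Cmod_R, Rabs_pos_eq by lra.
  reflexivity.
- intros E; apply RtoC_inj in E; lra.
Qed.

Lemma ex_series_Cmod_sinc_term (s : C) :
  ex_series (fun m => Cmod (sinc_term s m)).
Proof.
apply (ex_series_le (V := R_CompleteNormedModule)
         _ (fun m => (Cmod s ^ 2) ^ m / INR (fact m))).
- intros m; change (norm (Cmod (sinc_term s m)))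
    with (Rabs (Cmod (sinc_term s m))).
  rewrite Rabs_pos_eq by apply Cmod_ge_0.
  rewrite Cmod_sinc_term.
  apply Rmult_le_compat_l; [apply pow_le, pow2_ge_0|].
  apply Rinv_le_contravar; [apply INR_fact_lt_0|].
  apply le_INR, fact_le; lia.
- exists (exp (Cmod s ^ 2)).
  apply is_series_ext with (2 := is_exp_Reals (Cmod s ^ 2)).
  intros m; rewrite pow_n_pow; reflexivity.
Qed.

Lemma sinc_correct (s : C) :
  is_series (V := C_NormedModule) (sinc_term s) (sinc s).
Proof.
assert (Hre : is_series (fun m => Re (sinc_term s m)) (Re (sinc s))).
{ apply Series_correct.
  apply (ex_series_le (V := R_CompleteNormedModule)
           _ (fun m => Cmod (sinc_term s m))).
  - intros m; apply re_le_Cmod.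
  - apply ex_series_Cmod_sinc_term. }
assert (Him : is_series (fun m => Im (sinc_term s m)) (Im (sinc s))).
{ apply Series_correct.
  apply (ex_series_le (V := R_CompleteNormedModule)
           _ (fun m => Cmod (sinc_term s m))).
  - intros m; eapply Rle_trans; [apply Rmax_r|apply Rmax_Cmod].
  - apply ex_series_Cmod_sinc_term. }
assert (Hsum : forall n, sum_n (G := C_AbelianMonoid) (sinc_term s) n
   = (sum_n (fun m => Re (sinc_term s m)) n, sum_n (fun m => Im (sinc_term s m)) n)).
{ induction n as [|n IH].
  - rewrite !sum_O; apply surjective_pairing.
  - rewrite !sum_Sn, IH; reflexivity. }
apply filterlim_locally; intros eps.
generalize (proj1 (filterlim_locally _ _) Hre eps)
           (proj1 (filterlim_locally _ _) Him eps).
intros H1 H2; generalize (filter_and _ _ H1 H2).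
apply filter_imp; intros n [E1 E2].
rewrite Hsum; split; [exact E1|exact E2].
Qed.

(* Main.v *)
Require Import Defs.
From Stdlib Require Import Reals Factorial Lra Lia.
From Coquelicot Require Import Coquelicot.
Open Scope R_scope.

(* Let J_m = int_0^(pi/2) cos(zt) cos^m t dt, with z = 2 w / pi.  The derivative of
   m cos(zt) cos^(m-1) t sin t - sin(zt) z cos^m t gives
   (m^2 - z^2) J_m = m (m - 1) J_(m-2), hence, dividing by the case z = 0 (the Wallis
   integrals W_m),
   sinc w = prod_(k <= n) (1 - w^2 / (k^2 pi^2)) * J_(2n) / W_(2n).
   Since |cos(zt) - 1| <= K t^2 and t cos t <= sin t, J_(2n) / W_(2n) = 1 + O(1/n).
   The product in the statement is the quotient of the products for w = s - l and
   b = beta - l; as no factor for b vanishes, the identity for b at one large n already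
   shows sinc b <> 0. *)

(** * Coordinatewise calculus for complex functions of a real variable *)

Definition cderiv (f : R -> C) (t : R) (d : C) : Prop :=
  is_derive (fun x => Re (f x)) t (Re d) /\ is_derive (fun x => Im (f x)) t (Im d).

Lemma cderiv_eq (f : R -> C) (t : R) (d d' : C) :
  cderiv f t d -> d = d' -> cderiv f t d'.
Proof. now intros H <-. Qed.

Lemma cderiv_minus (f g : R -> C) (t : R) (df dg : C) :
  cderiv f t df -> cderiv g t dg -> cderiv (fun x => f x - g x)%C t (df - dg)%C.
Proof. intros [H1 H2] [H3 H4]; split; now apply (is_derive_minus (V := R_NormedModule)). Qed.

Lemma cderiv_scal (c : C) (f : R -> C) (t : R) (df : C) :
  cderiv f t df -> cderiv (fun x => c * f x)%C t (c * df)%C.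
Proof.
intros [H1 H2]; split.
- apply (is_derive_minus (V := R_NormedModule)); now apply is_derive_scal.
- apply (is_derive_plus (V := R_NormedModule)); now apply is_derive_scal.
Qed.

Lemma cderiv_mult_RtoC (f : R -> C) (g : R -> R) (t : R) (df : C) (dg : R) :
  cderiv f t df -> is_derive g t dg ->
  cderiv (fun x => f x * RtoC (g x))%C t (df * RtoC (g t) + f t * RtoC dg)%C.
Proof.
intros [H1 H2] H3.
assert (E : forall (h : R -> R) (dh : R), is_derive h t dh ->
  is_derive (fun x => h x * g x) t (dh * g t + h t * dg)).
{ intros h dh Hh; apply (is_derive_mult h g t dh dg Hh H3 Rmult_comm). }
split.
- apply is_derive_ext with (fun x => Re (f x) * g x).
  + intros x; unfold Re, Im; simpl; ring.
  + replace (Re _) with (Re df * g t + Re (f t) * dg)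
      by (unfold Re, Im; simpl; ring).
    now apply E.
- apply is_derive_ext with (fun x => Im (f x) * g x).
  + intros x; unfold Re, Im; simpl; ring.
  + replace (Im _) with (Im df * g t + Im (f t) * dg)
      by (unfold Re, Im; simpl; ring).
    now apply E.
Qed.

Definition ccont (f : R -> C) : Prop :=
  forall t, continuous (fun x => Re (f x)) t /\ continuous (fun x => Im (f x)) t.

Lemma ccont_cderiv (f df : R -> C) : (forall t, cderiv f t (df t)) -> ccont f.
Proof.
intros H t; destruct (H t) as [H1 H2].
split; apply (ex_derive_continuous (V := R_NormedModule)); eexists; eassumption.
Qed.

Lemma is_RInt_cderiv (f df : R -> C) (a b : R) :
  (forall t, cderiv f t (df t)) -> ccont df ->
  is_RInt (V := C_R_NormedModule) df a b (f b - f a)%C.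
Proof.
intros H Hc.
apply is_RInt_fct_extend_pair.
- apply (is_RInt_derive (fun x => Re (f x)) (fun x => Re (df x))); intros; [apply H|apply Hc].
- apply (is_RInt_derive (fun x => Im (f x)) (fun x => Im (df x))); intros; [apply H|apply Hc].
Qed.

Lemma is_RInt_ccont (f : R -> C) (a b : R) :
  ccont f -> is_RInt (V := C_R_NormedModule) f a b (RInt (V := C_R_CompleteNormedModule) f a b).
Proof.
intros Hf; apply (RInt_correct (V := C_R_CompleteNormedModule)).
apply ex_RInt_fct_extend_pair; apply (ex_RInt_continuous (V := R_CompleteNormedModule));
  intros t _; apply Hf.
Qed.

(** Integration treats C as a real module, so a complex factor is handled as two real linear
    combinations of the coordinate integrals. *)
Lemma is_RInt_Cmult (c : C) (f : R -> C) (a b : R) (I : C) :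
  is_RInt (V := C_R_NormedModule) f a b I ->
  is_RInt (V := C_R_NormedModule) (fun t => c * f t)%C a b (c * I)%C.
Proof.
intros H.
assert (H1 := is_RInt_fct_extend_fst _ _ _ _ H).
assert (H2 := is_RInt_fct_extend_snd _ _ _ _ H).
apply is_RInt_fct_extend_pair; simpl.
- apply (is_RInt_minus (V := R_NormedModule)); now apply (is_RInt_scal (V := R_NormedModule)).
- apply (is_RInt_plus (V := R_NormedModule)); now apply (is_RInt_scal (V := R_NormedModule)).
Qed.

Lemma Cmod_RInt_le (f : R -> C) (g : R -> R) (a b : R) (I : C) (K : R) :
  a <= b -> (forall t, a <= t <= b -> Cmod (f t) <= g t) ->
  is_RInt (V := C_R_NormedModule) f a b I -> is_RInt g a b K -> Cmod I <= K.
Proof.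
intros ab H Hf Hg.
(* The product norm on R * R is Euclidean, hence equal to [Cmod]; this keeps the triangle inequality
   for integrals free of any extra constant. *)
assert (E : forall z : C, @norm _ C_R_NormedModule z = Cmod z).
{ intros [x y]; unfold norm; simpl; unfold prod_norm, Cmod, norm; simpl; unfold abs; simpl.
  f_equal; rewrite !Rmult_1_r, <- !Rabs_mult.
  rewrite !Rabs_pos_eq by apply Rle_0_sqr; reflexivity. }
rewrite <- E.
apply (norm_RInt_le (V := C_R_NormedModule) f g a b); try assumption.
intros t Ht; rewrite E; now apply H.
Qed.

(** * Power series for the complex sine and cosine *)

Lemma CV_radius_infinite (a : nat -> R) :
  (forall x, is_lim_seq (fun n => a n * x ^ n) 0) -> CV_radius a = p_infty.
Proof.
intros H.
destruct (CV_radius a) as [r| |] eqn:E; [exfalso|reflexivity|exfalso].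
(* Outside the disk of convergence the terms cannot tend to 0; [Rabs r + 1] lies outside when the
   radius is the real [r], and 0 does when it is minus infinity. *)
- apply (CV_disk_outside a (Rabs r + 1)); [|apply H].
  rewrite E; simpl; rewrite (Rabs_pos_eq (Rabs r + 1)) by (generalize (Rabs_pos r); lra).
  generalize (Rle_abs r); lra.
- apply (CV_disk_outside a 0); [|apply H].
  rewrite E; exact I.
Qed.

Definition CPSeries (a : nat -> C) (x : R) : C :=
  (PSeries (fun m => Re (a m)) x, PSeries (fun m => Im (a m)) x).

Lemma sinc_term_RtoC_mult (z : C) (t : R) (m : nat) :
  sinc_term (z * RtoC t) m = (sinc_term z m * RtoC ((t ^ 2) ^ m))%C.
Proof.
unfold sinc_term, Cdiv.
rewrite Cpow_mult_l, <- (RtoC_pow t), pow_mult; ring.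
Qed.

Lemma sinc_CPSeries (z : C) (t : R) :
  sinc (z * RtoC t) = CPSeries (sinc_term z) (t ^ 2).
Proof.
unfold sinc, CPSeries, PSeries; f_equal; apply Series_ext; intros m;
  rewrite sinc_term_RtoC_mult; unfold Re, Im; simpl; ring.
Qed.

Lemma Cmod_Re_Im (c : C) : Rabs (Re c) <= Cmod c /\ Rabs (Im c) <= Cmod c.
Proof.
split; eapply Rle_trans; [|apply Rmax_Cmod| |apply Rmax_Cmod];
  [apply Rmax_l|apply Rmax_r].
Qed.

(** The number |a_m| |x|^m, with a_m = [sinc_term z m], is the modulus of the m-th term of the sinc
    series at z sqrt |x|. That series converges absolutely, so its terms tend to 0 for every x. *)
Lemma CV_radius_sinc_term (z : C) :
  CV_radius (fun m => Re (sinc_term z m)) = p_infty /\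
  CV_radius (fun m => Im (sinc_term z m)) = p_infty.
Proof.
assert (H : forall x, is_lim_seq (fun m => Cmod (sinc_term z m) * Rabs x ^ m) 0).
{ intros x.
  apply is_lim_seq_ext with (fun m => Cmod (sinc_term (z * RtoC (sqrt (Rabs x))) m)).
  - intros m; rewrite sinc_term_RtoC_mult, Cmod_mult, Cmod_R, pow2_sqrt by apply Rabs_pos.
    now rewrite (Rabs_pos_eq (_ ^ _)) by (apply pow_le, Rabs_pos).
  - apply ex_series_lim_0, ex_series_Cmod_sinc_term. }
split; apply CV_radius_infinite; intros x; apply is_lim_seq_abs_0;
  (eapply (is_lim_seq_le_le (fun _ => 0)); [|apply is_lim_seq_const|apply (H x)]);
  intros m; (split; [apply Rabs_pos|]);
  rewrite Rabs_mult, RPow_abs; apply Rmult_le_compat_r; try apply Rabs_pos; apply Cmod_Re_Im.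
Qed.

(* [sin (z t) / z] and [cos (z t)], as power series in [t ^ 2] so that [z = 0] is allowed. *)
Definition csin_div (z : C) (t : R) : C :=
  (CPSeries (sinc_term z) (t ^ 2) * RtoC t)%C.
Definition ccos (z : C) (t : R) : C :=
  CPSeries (fun m => sinc_term z m * RtoC (2 * INR m + 1))%C (t ^ 2).

(** If f(u) is the sum of a_m u^m, the derivative of t f(t^2) is f(u) + 2 u f'(u) at u = t^2; these
    are its coefficients in u. *)
Definition cos_coef (a : nat -> R) : nat -> R :=
  PS_plus a (PS_scal 2 (PS_incr_1 (PS_derive a))).

Lemma cos_coef_eq (a : nat -> R) (m : nat) : cos_coef a m = a m * (2 * INR m + 1).
Proof.
unfold cos_coef, PS_plus, PS_scal.
change (a m + 2 * PS_incr_1 (PS_derive a) m = a m * (2 * INR m + 1)).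
destruct m as [|m]; unfold PS_incr_1, PS_derive.
- change (a 0%nat + 2 * 0 = a 0%nat * (2 * 0 + 1)); ring.
- ring.
Qed.

Lemma CV_radius_cos_coef (a : nat -> R) :
  CV_radius a = p_infty -> CV_radius (cos_coef a) = p_infty.
Proof.
intros H.
generalize (CV_radius_plus a (PS_scal 2 (PS_incr_1 (PS_derive a)))).
rewrite CV_radius_scal, CV_radius_incr_1, CV_radius_derive, H by lra.
fold (cos_coef a); destruct (CV_radius (cos_coef a)); simpl; tauto.
Qed.

Lemma is_derive_PSeries_infinite (a : nat -> R) (x : R) :
  CV_radius a = p_infty -> is_derive (PSeries a) x (PSeries (PS_derive a) x).
Proof. intros H; apply is_derive_PSeries; rewrite H; exact I. Qed.

Lemma is_derive_sqr_comp (f : R -> R) (t d : R) :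
  is_derive f (t ^ 2) d -> is_derive (fun x => f (x ^ 2)) t (2 * t * d).
Proof.
intros H.
apply (is_derive_comp f (fun x => x ^ 2) t d (2 * t) H).
auto_derive; [trivial|ring].
Qed.

Lemma is_derive_mult_PSeries_sqr (a : nat -> R) (t : R) :
  CV_radius a = p_infty ->
  is_derive (fun x => PSeries a (x ^ 2) * x) t (PSeries (cos_coef a) (t ^ 2)).
Proof.
intros H.
assert (Hin : forall b, CV_radius b = p_infty -> ex_pseries b (t ^ 2)).
{ intros b Hb; apply CV_radius_inside; rewrite Hb; exact I. }
unfold cos_coef; rewrite PSeries_plus, PSeries_scal, PSeries_incr_1.
- replace (_ + _) with (2 * t * PSeries (PS_derive a) (t ^ 2) * t + PSeries a (t ^ 2) * 1) by ring.
  apply (is_derive_mult (fun x => PSeries a (x ^ 2)) (fun x => x)).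
  + now apply is_derive_sqr_comp, is_derive_PSeries_infinite.
  + exact (is_derive_id t).
  + exact Rmult_comm.
- now apply Hin.
- apply Hin; now rewrite CV_radius_scal, CV_radius_incr_1, CV_radius_derive by lra.
Qed.

Lemma ccos_pair (z : C) (t : R) :
  ccos z t = (PSeries (cos_coef (fun m => Re (sinc_term z m))) (t ^ 2),
              PSeries (cos_coef (fun m => Im (sinc_term z m))) (t ^ 2)).
Proof.
unfold ccos, CPSeries; f_equal; apply PSeries_ext; intros m; rewrite cos_coef_eq;
  unfold Re, Im; simpl; ring.
Qed.

Lemma cderiv_csin_div (z : C) (t : R) : cderiv (csin_div z) t (ccos z t).
Proof.
rewrite ccos_pair; destruct (CV_radius_sinc_term z) as [H1 H2].
split; simpl.
- eapply is_derive_ext; [|apply is_derive_mult_PSeries_sqr, H1].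
  intros x; unfold csin_div, CPSeries, Re, Im; simpl; ring.
- eapply is_derive_ext; [|apply is_derive_mult_PSeries_sqr, H2].
  intros x; unfold csin_div, CPSeries, Re, Im; simpl; ring.
Qed.

(** This is the derivative of cos(zt) read off coefficient by coefficient: in the variable u = t^2,
    the derivative of the cosine series is -z^2/2 times the sinc series. *)
Lemma sinc_term_succ (z : C) (m : nat) :
  (RtoC (INR (S m)) * (sinc_term z (S m) * RtoC (2 * INR (S m) + 1)))%C
  = (- (z ^ 2 / 2) * sinc_term z m)%C.
Proof.
unfold sinc_term.
replace (2 * S m)%nat with (2 + 2 * m)%nat by lia.
replace (2 + 2 * m + 1)%nat with (S (S (2 * m + 1))) by lia.
rewrite (Cpow_add_r z 2), Cpow_S.
rewrite !fact_simpl, !mult_INR, !S_INR, !plus_INR, !mult_INR.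
replace (INR 2) with 2 by (simpl; ring). replace (INR 1) with 1 by reflexivity.
repeat rewrite ?RtoC_mult, ?RtoC_plus.
assert (N : forall r, 0 < r -> RtoC r <> 0%C).
{ intros r Hr E; apply RtoC_inj in E; lra. }
generalize (pos_INR m); intros Hm.
field.
repeat split; rewrite <- ?RtoC_mult, <- ?RtoC_plus; apply N; try lra.
apply INR_fact_lt_0.
Qed.

Lemma PSeries_lin_comb (p q : R) (a b : nat -> R) (x : R) :
  CV_radius a = p_infty -> CV_radius b = p_infty ->
  PSeries (fun m => p * a m + q * b m) x = p * PSeries a x + q * PSeries b x.
Proof.
intros Ha Hb.
assert (Hin : forall c r, CV_radius c = p_infty -> ex_series (fun n => r * (c n * x ^ n))).
{ intros c r Hc; apply (ex_series_scal (V := R_NormedModule) r (fun n => c n * x ^ n)).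
  apply (ex_pseries_R c x), CV_radius_inside.
  rewrite Hc; exact I. }
unfold PSeries; rewrite <- !Series_scal_l, <- Series_plus by now apply Hin.
apply Series_ext; intros m; ring.
Qed.

Lemma cderiv_ccos (z : C) (t : R) : cderiv (ccos z) t (- z ^ 2 * csin_div z t)%C.
Proof.
destruct (CV_radius_sinc_term z) as [H1 H2].
(* Real and imaginary parts of [sinc_term_succ]: multiplication by -z^2/2 mixes the two real
   coefficient sequences linearly, which is the shape that [PSeries_lin_comb] sums. *)
assert (E : forall m,
  PS_derive (cos_coef (fun k => Re (sinc_term z k))) m
    = Re (- (z ^ 2 / 2))%C * Re (sinc_term z m) + Im (z ^ 2 / 2)%C * Im (sinc_term z m) /\
  PS_derive (cos_coef (fun k => Im (sinc_term z k))) m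
    = Re (- (z ^ 2 / 2))%C * Im (sinc_term z m) + Im (- (z ^ 2 / 2))%C * Re (sinc_term z m)).
{ intros m; generalize (sinc_term_succ z m); unfold PS_derive; rewrite !cos_coef_eq.
  generalize (sinc_term z (S m)) (sinc_term z m) (INR (S m)) (z ^ 2 / 2)%C.
  intros [u v] [u' v'] r [c d] H; injection H; intros I1 I2; unfold Re, Im; simpl in *; nra. }
assert (H : forall c d, (- z ^ 2 * ((c, d) * RtoC t))%C
   = (2 * t * (Re (- (z ^ 2 / 2))%C * c + Im (z ^ 2 / 2)%C * d),
      2 * t * (Re (- (z ^ 2 / 2))%C * d + Im (- (z ^ 2 / 2))%C * c))).
{ intros c d; replace (z ^ 2)%C with (2 * (z ^ 2 / 2))%C at 1
    by (field; intros E0; apply RtoC_inj in E0; lra).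
  generalize (z ^ 2 / 2)%C; intros [p q]; unfold Re, Im; apply injective_projections; simpl; ring. }
unfold csin_div, CPSeries; rewrite H, <- !PSeries_lin_comb by assumption.
assert (D : forall a b, CV_radius a = p_infty -> (forall m, PS_derive (cos_coef a) m = b m) ->
  is_derive (fun x => PSeries (cos_coef a) (x ^ 2)) t (2 * t * PSeries b (t ^ 2))).
{ intros a b Ha Hb; rewrite <- (PSeries_ext _ _ _ Hb).
  now apply is_derive_sqr_comp, is_derive_PSeries_infinite, CV_radius_cos_coef. }
split; (eapply is_derive_ext; [intros x; now rewrite ccos_pair|]); apply D;
  try assumption; apply E.
Qed.

Lemma ccos_0 (z : C) : ccos z 0 = 1%C.
Proof.
unfold ccos, CPSeries; rewrite pow_ne_zero by lia; rewrite !PSeries_0.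
unfold sinc_term; simpl; apply injective_projections; simpl; field.
Qed.

Lemma csin_div_0 (z : C) : csin_div z 0 = 0%C.
Proof. unfold csin_div; ring. Qed.

Lemma ccont_ccos (z : C) : ccont (ccos z).
Proof. exact (ccont_cderiv _ _ (cderiv_ccos z)). Qed.

Lemma ccont_csin_div (z : C) : ccont (csin_div z).
Proof. exact (ccont_cderiv _ _ (cderiv_csin_div z)). Qed.

(** * Boundedness, and estimates near 0 *)

Lemma ccont_bounded (f : R -> C) (a b : R) :
  ccont f -> exists M, forall t, a <= t <= b -> Cmod (f t) <= M.
Proof.
intros Hf.
destruct (bounded_continuity (V := R_NormedModule) (fun x => Re (f x)) a b) as [M1 H1];
  [intros x _; apply Hf|].
destruct (bounded_continuity (V := R_NormedModule) (fun x => Im (f x)) a b) as [M2 H2];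
  [intros x _; apply Hf|].
exists (sqrt 2 * Rmax M1 M2); intros t Ht.
eapply Rle_trans; [apply Cmod_2Rmax|].
apply Rmult_le_compat_l; [apply sqrt_pos|].
apply Rmax_lub; eapply Rle_trans; [|apply Rmax_l| |apply Rmax_r]; apply Rlt_le;
  [apply H1|apply H2]; assumption.
Qed.

Lemma Cmod_cderiv_le (f df : R -> C) (a b M : R) :
  (forall t, cderiv f t (df t)) -> ccont df -> a <= b ->
  (forall t, a <= t <= b -> Cmod (df t) <= M) -> Cmod (f b - f a) <= (b - a) * M.
Proof.
intros H Hc ab HM.
apply (Cmod_RInt_le df (fun _ => M) a b); try assumption.
- now apply is_RInt_cderiv.
- apply (is_RInt_const (V := R_NormedModule)).
Qed.

Lemma ccont_scal (c : C) (f : R -> C) : ccont f -> ccont (fun t => c * f t)%C.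
Proof.
intros H t; destruct (H t) as [H1 H2]; split.
- apply (continuous_minus (V := R_NormedModule));
    apply (continuous_scal_r (V := R_NormedModule)); assumption.
- apply (continuous_plus (V := R_NormedModule));
    apply (continuous_scal_r (V := R_NormedModule)); assumption.
Qed.

Lemma ccont_mult_RtoC (f : R -> C) (g : R -> R) :
  ccont f -> (forall t, continuous g t) -> ccont (fun t => f t * RtoC (g t))%C.
Proof.
intros H Hg t; destruct (H t) as [H1 H2]; split.
- apply continuous_ext with (fun x => Re (f x) * g x).
  + intros x; unfold Re, Im; simpl; ring.
  + now apply (continuous_mult (K := R_AbsRing)).
- apply continuous_ext with (fun x => Im (f x) * g x).
  + intros x; unfold Re, Im; simpl; ring.
  + now apply (continuous_mult (K := R_AbsRing)).
Qed.

(** The mean value inequality is used twice from 0: a bound M on the cosine gives |sin(zt)/z| <= t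
    M, and the cosine has derivative -z^2 times that function. *)
Lemma ccos_bound (z : C) (T : R) :
  exists K, 0 <= K /\ forall t, 0 <= t <= T -> Cmod (ccos z t - 1) <= K * t ^ 2.
Proof.
destruct (ccont_bounded (ccos z) 0 T (ccont_ccos z)) as [M HM].
assert (HU : forall t, 0 <= t <= T -> Cmod (csin_div z t) <= t * M).
{ intros t Ht.
  replace (csin_div z t) with (csin_div z t - csin_div z 0)%C by (rewrite csin_div_0; ring).
  replace (t * M) with ((t - 0) * M) by ring.
  apply Cmod_cderiv_le with (ccos z); [apply cderiv_csin_div|apply ccont_ccos|lra|].
  intros x Hx; apply HM; lra. }
(* For T < 0 the interval is empty and M may be negative; the absolute value keeps the constant
   nonnegative in all cases. *)
exists (Cmod z ^ 2 * Rabs M); split.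
{ apply Rmult_le_pos; [apply pow2_ge_0|apply Rabs_pos]. }
intros t Ht; rewrite <- (ccos_0 z).
replace (_ * t ^ 2) with ((t - 0) * (Cmod z ^ 2 * (t * Rabs M))) by ring.
apply Cmod_cderiv_le with (fun x => - z ^ 2 * csin_div z x)%C;
  [apply cderiv_ccos|apply ccont_scal, ccont_csin_div|lra|].
intros x Hx; rewrite Cmod_mult, Cmod_opp, Cmod_pow.
apply Rmult_le_compat_l; [apply pow2_ge_0|].
eapply Rle_trans; [apply HU; lra|].
apply Rle_trans with (x * Rabs M).
- apply Rmult_le_compat_l; [lra|apply Rle_abs].
- apply Rmult_le_compat_r; [apply Rabs_pos|lra].
Qed.

(** The difference sin t - t cos t vanishes at 0 and has derivative t sin t >= 0. *)
Lemma mult_cos_le_sin (t : R) : 0 <= t <= PI / 2 -> t * cos t <= sin t.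
Proof.
intros Ht.
destruct (MVT_gen (fun x => sin x - x * cos x) 0 t (fun x => x * sin x)) as [c [Hc E]].
- intros x _; auto_derive; [trivial|ring].
- intros x _; apply continuity_pt_filterlim.
  apply (ex_derive_continuous (V := R_NormedModule) (fun y => sin y - y * cos y)).
  auto_derive; trivial.
- rewrite Rmin_left, Rmax_right in Hc by lra.
  rewrite sin_0 in E.
  assert (0 <= c * sin c * (t - 0)).
  { apply Rmult_le_pos; [apply Rmult_le_pos|]; try lra. apply sin_ge_0; lra. }
  lra.
Qed.

(** * Wallis integrals *)

Definition wallis (m : nat) : R := RInt (fun t => cos t ^ m) 0 (PI / 2).

Lemma is_RInt_wallis (m : nat) : is_RInt (fun t => cos t ^ m) 0 (PI / 2) (wallis m).
Proof.
apply (RInt_correct (V := R_CompleteNormedModule)).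
apply (ex_RInt_continuous (V := R_CompleteNormedModule)).
intros t _; apply (ex_derive_continuous (V := R_NormedModule)); auto_derive; trivial.
Qed.

Lemma wallis_pos (m : nat) : 0 < wallis m.
Proof.
generalize PI_RGT_0; intros HP.
apply RInt_gt_0; [lra| |].
- intros t Ht; apply pow_lt, cos_gt_0; lra.
- intros t _; apply (ex_derive_continuous (V := R_NormedModule)); auto_derive; trivial.
Qed.

Lemma is_derive_cos_pow_sin (m : nat) (t : R) :
  is_derive (fun x => cos x ^ S m * sin x) t
    ((INR m + 2) * cos t ^ S (S m) - (INR m + 1) * cos t ^ m).
Proof.
auto_derive; [trivial|].
change (match m with 0%nat => 1 | S _ => INR m + 1 end) with (INR (S m)); rewrite S_INR.
replace (1 * - sin t * ((INR m + 1) * cos t ^ m) * sin t)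
  with (- (INR m + 1) * cos t ^ m * Rsqr (sin t)) by (unfold Rsqr; ring).
rewrite sin2; unfold Rsqr; simpl; ring.
Qed.

Lemma is_derive_cos_pow (m : nat) (t : R) :
  is_derive (fun x => cos x ^ S (S m)) t (- (INR m + 2) * (cos t ^ S m * sin t)).
Proof.
auto_derive; [trivial|].
change (match m with 0%nat => 1 | S _ => INR m + 1 end) with (INR (S m)); rewrite S_INR.
simpl; ring.
Qed.

(** Integrate the derivative of cos^(m+1) t sin t, a function that vanishes at both ends of the
    interval. *)
Lemma wallis_rec (m : nat) : (INR m + 2) * wallis (S (S m)) = (INR m + 1) * wallis m.
Proof.
assert (H : is_RInt (fun t => (INR m + 2) * cos t ^ S (S m) - (INR m + 1) * cos t ^ m) 0 (PI / 2)
  ((INR m + 2) * wallis (S (S m)) - (INR m + 1) * wallis m)).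
{ apply (is_RInt_minus (V := R_NormedModule)); apply (is_RInt_scal (V := R_NormedModule));
    apply is_RInt_wallis. }
apply (is_RInt_unique (V := R_CompleteNormedModule)) in H.
erewrite (is_RInt_unique (V := R_CompleteNormedModule)) in H;
  [|apply (is_RInt_derive (V := R_CompleteNormedModule) (fun t => cos t ^ S m * sin t))].
- unfold minus, plus, opp in H; simpl in H; rewrite cos_PI2, sin_0 in H; lra.
- intros x _; apply is_derive_cos_pow_sin.
- intros x _; apply (ex_derive_continuous (V := R_NormedModule)); auto_derive; trivial.
Qed.

(** * The integrals J_m of cos(zt) cos^m t *)

Definition ccos_int (z : C) (m : nat) : C :=
  RInt (V := C_R_CompleteNormedModule) (fun t => ccos z t * RtoC (cos t ^ m))%C 0 (PI / 2).

Lemma is_RInt_ccos_int (z : C) (m : nat) :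
  is_RInt (V := C_R_NormedModule) (fun t => ccos z t * RtoC (cos t ^ m))%C 0 (PI / 2)
    (ccos_int z m).
Proof.
apply is_RInt_ccont, ccont_mult_RtoC; [apply ccont_ccos|].
intros t; apply (ex_derive_continuous (V := R_NormedModule)); auto_derive; trivial.
Qed.

(** [csin_div z] is a primitive of [ccos z] that vanishes at 0, and its value at PI / 2 is a sinc by
    definition. *)
Lemma ccos_int_0 (z : C) : ccos_int z 0 = (sinc (z * RtoC (PI / 2)) * RtoC (PI / 2))%C.
Proof.
rewrite sinc_CPSeries.
change (ccos_int z 0 = csin_div z (PI / 2)).
replace (csin_div z (PI / 2)) with (csin_div z (PI / 2) - csin_div z 0)%C
  by (rewrite csin_div_0; ring).
apply (is_RInt_unique (V := C_R_CompleteNormedModule)).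
apply (is_RInt_ext (V := C_R_NormedModule) (ccos z)).
- intros t _; simpl; ring.
- apply is_RInt_cderiv; [apply cderiv_csin_div|apply ccont_ccos].
Qed.

(** The recurrence stays free of division because (m + 2)^2 = z^2 can occur; it comes from
    integrating an exact derivative. *)
Lemma ccos_int_rec (z : C) (m : nat) :
  ((RtoC (INR m + 2) ^ 2 - z ^ 2) * ccos_int z (S (S m))
   = RtoC (INR m + 2) * RtoC (INR m + 1) * ccos_int z m)%C.
Proof.
set (g := fun t => ((RtoC (INR m + 2) ^ 2 - z ^ 2) * (ccos z t * RtoC (cos t ^ S (S m)))
  - RtoC (INR m + 2) * RtoC (INR m + 1) * (ccos z t * RtoC (cos t ^ m)))%C).
(* A primitive of [g]; z^2 [csin_div z t] stands for z sin(zt). *)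
set (F := fun t => (RtoC (INR m + 2) * (ccos z t * RtoC (cos t ^ S m * sin t))
  - z ^ 2 * (csin_div z t * RtoC (cos t ^ S (S m))))%C).
assert (H : is_RInt (V := C_R_NormedModule) g 0 (PI / 2)
  ((RtoC (INR m + 2) ^ 2 - z ^ 2) * ccos_int z (S (S m))
   - RtoC (INR m + 2) * RtoC (INR m + 1) * ccos_int z m)%C).
{ apply (is_RInt_minus (V := C_R_NormedModule)); apply is_RInt_Cmult; apply is_RInt_ccos_int. }
assert (Hc : forall k, ccont (fun t => ccos z t * RtoC (cos t ^ k))%C).
{ intros k; apply ccont_mult_RtoC; [apply ccont_ccos|].
  intros t; apply (ex_derive_continuous (V := R_NormedModule)); auto_derive; trivial. }
assert (H' : is_RInt (V := C_R_NormedModule) g 0 (PI / 2) (F (PI / 2)%R - F 0%R)%C).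
{ apply is_RInt_cderiv.
  - intros t.
    eapply cderiv_eq.
    + apply cderiv_minus; apply cderiv_scal; apply cderiv_mult_RtoC.
      * apply cderiv_ccos.
      * apply is_derive_cos_pow_sin.
      * apply cderiv_csin_div.
      * apply is_derive_cos_pow.
    + unfold g.
      rewrite RtoC_minus, !RtoC_mult, RtoC_opp.
      generalize (RtoC (INR m + 2)) (RtoC (INR m + 1)) (RtoC (cos t ^ S (S m)))
        (RtoC (cos t ^ S m)) (RtoC (cos t ^ m)); intros; ring.
  - intros t; destruct (ccont_scal (RtoC (INR m + 2) ^ 2 - z ^ 2) _ (Hc (S (S m))) t) as [A1 A2].
    destruct (ccont_scal (RtoC (INR m + 2) * RtoC (INR m + 1)) _ (Hc m) t) as [B1 B2].
    split; now apply (continuous_minus (V := R_NormedModule)). }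
apply (is_RInt_unique (V := C_R_CompleteNormedModule)) in H.
apply (is_RInt_unique (V := C_R_CompleteNormedModule)) in H'.
rewrite H in H'.
(* [F] vanishes at 0 through its two sine factors, and at PI / 2 through positive powers of the
   cosine. *)
unfold F in H'; rewrite csin_div_0, cos_PI2, sin_0, Rmult_0_r in H'.
rewrite !pow_ne_zero, Rmult_0_l in H' by lia.
match goal with |- ?X = ?Y => replace X with (X - Y + Y)%C by ring end.
rewrite H'; ring.
Qed.

(** The right side is a difference of Wallis integrals because [wallis_rec] makes it K W_(m+2) / (m
    + 1), which is small relative to W_(m+2). *)
Lemma ccos_int_wallis_le (z : C) :
  exists K, 0 <= K /\ forall m,
    Cmod (ccos_int z (S (S m)) - RtoC (wallis (S (S m)))) <= K * (wallis m - wallis (S (S m))).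
Proof.
destruct (ccos_bound z (PI / 2)) as [K [K0 HK]].
exists K; split; [assumption|]; intros m.
generalize PI_RGT_0; intros HP.
apply (Cmod_RInt_le (fun t => ccos z t * RtoC (cos t ^ S (S m)) - RtoC (cos t ^ S (S m)))%C
  (fun t => K * (cos t ^ m - cos t ^ S (S m))) 0 (PI / 2)).
- lra.
- intros t Ht.
  assert (Hc : 0 <= cos t) by (apply cos_ge_0; lra).
  replace (_ - _)%C with ((ccos z t - 1) * RtoC (cos t ^ S (S m)))%C by ring.
  rewrite Cmod_mult, Cmod_R, Rabs_pos_eq by now apply pow_le.
  (* [t cos t <= sin t] turns [t^2 cos^2 t] into [sin^2 t = 1 - cos^2 t] *)
  apply Rle_trans with (K * (t * cos t) ^ 2 * cos t ^ m).
  + replace (K * (t * cos t) ^ 2 * cos t ^ m) with (K * t ^ 2 * cos t ^ S (S m)) by (simpl; ring).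
    apply Rmult_le_compat_r; [now apply pow_le|now apply HK].
  + replace (K * (cos t ^ m - cos t ^ S (S m))) with (K * (sin t) ^ 2 * cos t ^ m).
    * apply Rmult_le_compat_r; [now apply pow_le|].
      apply Rmult_le_compat_l; [assumption|].
      apply pow_incr; split; [|now apply mult_cos_le_sin].
      apply Rmult_le_pos; [apply Ht|assumption].
    * rewrite <- Rsqr_pow2, sin2; unfold Rsqr; simpl; ring.
- apply (is_RInt_minus (V := C_R_NormedModule)); [apply is_RInt_ccos_int|].
  apply is_RInt_fct_extend_pair; simpl.
  + apply (is_RInt_wallis (S (S m))).
  + evar_last; [apply (is_RInt_const (V := R_NormedModule))|exact (Rmult_0_r _)].
- apply (is_RInt_scal (V := R_NormedModule)), (is_RInt_minus (V := R_NormedModule));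
    apply is_RInt_wallis.
Qed.

(** * Partial products of sinc and their correction factors *)

Lemma RtoC_neq_0 (r : R) : r <> 0 -> RtoC r <> 0%C.
Proof. intros H E; apply H, RtoC_inj, E. Qed.

(** The correction factor J_(2n) / W_(2n) at z = 2 w / pi. Its denominator is positive, so it keeps
    its meaning when the partial product of sinc w vanishes. *)
Definition sinc_ratio (w : C) (n : nat) : C :=
  (ccos_int (w * RtoC (2 / PI)) (2 * n) / RtoC (wallis (2 * n)))%C.

Lemma sinc_ratio_bound (w : C) :
  exists K, 0 <= K /\ forall n, Cmod (sinc_ratio w (S n) - 1) <= K / INR (S n).
Proof.
destruct (ccos_int_wallis_le (w * RtoC (2 / PI))) as [K [K0 HK]].
exists K; split; [assumption|]; intros n.
unfold sinc_ratio; replace (2 * S n)%nat with (S (S (2 * n))) by lia.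
generalize (wallis_pos (S (S (2 * n)))); intros HW.
assert (HW' : RtoC (wallis (S (S (2 * n)))) <> 0%C) by (apply RtoC_neq_0; lra).
replace (_ - 1)%C with ((ccos_int (w * RtoC (2 / PI)) (S (S (2 * n)))
  - RtoC (wallis (S (S (2 * n))))) / RtoC (wallis (S (S (2 * n)))))%C by now field.
rewrite Cmod_div, Cmod_R, Rabs_pos_eq by (assumption || lra).
apply Rle_trans with (K * (wallis (2 * n) - wallis (S (S (2 * n)))) / wallis (S (S (2 * n)))).
{ apply Rmult_le_compat_r; [apply Rlt_le, Rinv_0_lt_compat, HW|apply HK]. }
unfold Rdiv; rewrite Rmult_assoc; apply Rmult_le_compat_l; [assumption|].
generalize (wallis_rec (2 * n)) (pos_INR n); rewrite (S_INR n), (mult_INR 2 n).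
simpl (INR 2); intros E Hn.
apply Rmult_le_reg_r with (wallis (S (S (2 * n)))); [assumption|].
rewrite Rmult_assoc, Rinv_l, Rmult_1_r by lra.
(* By [wallis_rec] the difference is W_(2n+2) / (2n + 1), and 2n + 1 >= n + 1. *)
replace (wallis (2 * n) - _) with (/ (2 * INR n + 1) * wallis (S (S (2 * n)))).
- apply Rmult_le_compat_r; [lra|]. apply Rinv_le_contravar; lra.
- apply Rmult_eq_reg_l with (2 * INR n + 1); [|lra].
  rewrite <- Rmult_assoc, Rinv_r by lra; lra.
Qed.

Definition sinc_prod (w : C) : nat -> C :=
  Cprod (fun k => 1 - w ^ 2 / (RtoC (INR k) ^ 2 * RtoC PI ^ 2))%C.

(** Induction on n, with both recurrences taken at 2n. For z = 2 w / pi, the quotient ((2n + 2)^2 -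
    z^2) / (2n + 2)^2 is the new factor 1 - w^2 / ((n + 1)^2 pi^2). *)
Lemma sinc_partial_prod (w : C) (n : nat) :
  sinc w = (sinc_prod w n * sinc_ratio w n)%C.
Proof.
generalize PI_RGT_0; intros HP.
assert (HPC : RtoC PI <> 0%C) by (apply RtoC_neq_0; lra).
induction n as [|n IH].
- unfold sinc_prod, sinc_ratio; simpl Cprod; replace (2 * 0)%nat with 0%nat by lia.
  rewrite ccos_int_0.
  replace (w * RtoC (2 / PI) * RtoC (PI / 2))%C with w.
  + replace (wallis 0) with (PI / 2).
    * field; apply RtoC_neq_0; lra.
    * unfold wallis; simpl; rewrite RInt_const; unfold scal; simpl; unfold mult; simpl; ring.
  + rewrite <- Cmult_assoc, <- RtoC_mult; replace (2 / PI * (PI / 2)) with 1 by (field; lra); ring.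
- rewrite IH; unfold sinc_prod, sinc_ratio; simpl Cprod.
  rewrite <- Cmult_assoc; f_equal.
  replace (2 * S n)%nat with (S (S (2 * n))) by lia.
  generalize (ccos_int_rec (w * RtoC (2 / PI)) (2 * n)) (wallis_rec (2 * n)).
  generalize (wallis_pos (2 * n)) (wallis_pos (S (S (2 * n)))).
  generalize (wallis (2 * n)) (wallis (S (S (2 * n)))) (ccos_int (w * RtoC (2 / PI)) (2 * n))
    (ccos_int (w * RtoC (2 / PI)) (S (S (2 * n)))) (pos_INR n).
  change (match n with 0%nat => 1 | S _ => INR n + 1 end) with (INR (S n)).
  rewrite (S_INR n), (mult_INR 2 n); simpl (INR 2); generalize (INR n).
  intros k W W' J J' Hk HW HW' HJ HR.
  assert (N1 : RtoC (k + 1) <> 0%C) by (apply RtoC_neq_0; lra).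
  assert (N2 : RtoC (2 * k + 1) <> 0%C) by (apply RtoC_neq_0; lra).
  assert (N3 : RtoC W' <> 0%C) by (apply RtoC_neq_0; lra).
  assert (N4 : RtoC 2 <> 0%C) by (apply RtoC_neq_0; lra).
  replace ((1 + 1) * k + 2) with (2 * (k + 1)) in HJ, HR by ring.
  replace ((1 + 1) * k + 1) with (2 * k + 1) in HJ, HR by ring.
  (* Solving for the earlier integral [J] divides only by positive numbers; the coefficient of [J']
     may be 0. *)
  assert (EJ : J = (((RtoC (2 * (k + 1))) ^ 2 - (w * RtoC (2 / PI)) ^ 2) * J'
    / (RtoC (2 * (k + 1)) * RtoC (2 * k + 1)))%C).
  { rewrite HJ, RtoC_mult; field; auto. }
  assert (EW : RtoC W = (RtoC (2 * (k + 1)) * RtoC W' / RtoC (2 * k + 1))%C).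
  { rewrite <- RtoC_mult, HR, RtoC_mult; now field. }
  rewrite EJ, EW, RtoC_div, RtoC_mult by lra.
  field; auto.
Qed.

Lemma sinc_ratio_near_1 (w : C) (eps : R) :
  0 < eps -> exists N, forall n, (N <= n)%nat -> Cmod (sinc_ratio w n - 1) < eps.
Proof.
intros He; destruct (sinc_ratio_bound w) as [K [K0 HK]].
destruct (INR_unbounded (K / eps)) as [N HN].
exists (S N); intros [|n] Hn; [lia|].
eapply Rle_lt_trans; [apply HK|].
assert (INR N <= INR (S n)) by (apply le_INR; lia).
assert (0 <= K / eps) by (apply Rmult_le_pos; [|apply Rlt_le, Rinv_0_lt_compat]; assumption).
apply Rmult_lt_reg_r with (INR (S n) / eps); [apply Rdiv_lt_0_compat; lra|].
replace (K / INR (S n) * (INR (S n) / eps)) with (K / eps) by (field; split; lra).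
replace (eps * (INR (S n) / eps)) with (INR (S n)) by (field; lra).
lra.
Qed.

Lemma Cmod_ge_half (c : C) : Cmod (c - 1) < / 2 -> / 2 < Cmod c.
Proof.
intros H; generalize (Cmod_triangle c (- (c - 1))).
replace (c + - (c - 1))%C with (RtoC 1) by ring.
rewrite Cmod_opp, Cmod_R, Rabs_R1; lra.
Qed.

Lemma sinc_neq_0 (b : C) :
  (forall n, sinc_prod b n <> 0%C) -> sinc b <> 0%C.
Proof.
intros Hb; destruct (sinc_ratio_near_1 b (/ 2)) as [N HN]; [lra|].
rewrite (sinc_partial_prod b N); apply Cmult_neq_0; [apply Hb|].
apply Cmod_gt_0; generalize (Cmod_ge_half _ (HN N (Nat.le_refl N))); lra.
Qed.

(** * Convergence of the infinite product *)

Lemma is_infprod_Cmod (a : nat -> C) (p : C) :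
  (forall eps, 0 < eps -> exists N, forall n, (N <= n)%nat -> Cmod (Cprod a n - p) < eps) ->
  is_infprod a p.
Proof.
intros H; apply filterlim_locally; intros eps.
destruct (H eps (cond_pos eps)) as [N HN]; exists N; intros n Hn.
(* Balls in the product uniform structure are squares, and a disk lies in the square of the same
   radius. *)
destruct (Cmod_Re_Im (Cprod a n - p)) as [H1 H2]; specialize (HN n Hn).
split; (eapply Rle_lt_trans; [|exact HN]); [exact H1|exact H2].
Qed.

(** Write r_w and r_b for the correction factors. The n-th partial product is (sinc w / sinc b) (r_b
    / r_w), and both factors tend to 1. *)
Lemma is_infprod_sinc_quotient (a : nat -> C) (w b : C) :
  (forall n, sinc_prod b n <> 0%C) ->
  (forall n, (Cprod a n * sinc_prod b n)%C = sinc_prod w n) ->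
  is_infprod a (sinc w / sinc b)%C.
Proof.
intros Hb Ha; assert (Hs := sinc_neq_0 b Hb).
apply is_infprod_Cmod; intros eps He.
set (M := Cmod (sinc w / sinc b)).
assert (M0 : 0 <= M) by apply Cmod_ge_0.
(* The error is M |r_b - r_w| / |r_w| with |r_b - r_w| <= 2 d and |r_w| > 1/2, hence at most 4 M d <
   eps; M + 1 covers M = 0. *)
set (d := eps / (4 * (M + 1))).
assert (Hd : 0 < d) by (apply Rdiv_lt_0_compat; lra).
destruct (sinc_ratio_near_1 w (Rmin d (/ 2))) as [N1 H1]; [apply Rmin_pos; lra|].
destruct (sinc_ratio_near_1 b d) as [N2 H2]; [assumption|].
exists (max N1 N2); intros n Hn.
specialize (H1 n ltac:(lia)); specialize (H2 n ltac:(lia)).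
assert (H1d := Rlt_le_trans _ _ _ H1 (Rmin_l _ _)).
assert (Hw := Cmod_ge_half _ (Rlt_le_trans _ _ _ H1 (Rmin_r _ _))).
assert (Hw0 : sinc_ratio w n <> 0%C) by (apply Cmod_gt_0; lra).
replace (Cprod a n - sinc w / sinc b)%C
  with (sinc w / sinc b * ((sinc_ratio b n - 1) - (sinc_ratio w n - 1)) / sinc_ratio w n)%C.
- rewrite Cmod_div, Cmod_mult by assumption; fold M.
  assert (Ht : Cmod ((sinc_ratio b n - 1) - (sinc_ratio w n - 1)) <= 2 * d).
  { eapply Rle_trans; [apply Cmod_triangle|]; rewrite Cmod_opp; lra. }
  apply Rmult_lt_reg_r with (Cmod (sinc_ratio w n)); [lra|].
  unfold Rdiv; rewrite Rmult_assoc, Rinv_l, Rmult_1_r by lra.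
  apply Rle_lt_trans with (M * (2 * d)); [now apply Rmult_le_compat_l|].
  apply Rlt_trans with (eps * / 2); [|now apply Rmult_lt_compat_l].
  replace eps with (d * (4 * (M + 1))) by (unfold d; field; lra).
  nra.
(* The relation is cross-multiplied, since the partial product for [w] may vanish. *)
- assert (E : (sinc_ratio w n * Cprod a n * sinc b)%C = (sinc w * sinc_ratio b n)%C).
  { rewrite (sinc_partial_prod b n), (sinc_partial_prod w n), <- Ha; ring. }
  replace (Cprod a n) with (sinc w * sinc_ratio b n / (sinc_ratio w n * sinc b))%C.
  + now field.
  + rewrite <- E; now field.
Qed.

Lemma Cprod_succ (a : nat -> C) (n : nat) : Cprod a (S n) = (Cprod a n * a (S n))%C.
Proof. reflexivity. Qed.

Lemma sinc_prod_succ (w : C) (n : nat) :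
  sinc_prod w (S n)
  = (sinc_prod w n * (1 - w ^ 2 / (RtoC (INR (S n)) ^ 2 * RtoC PI ^ 2)))%C.
Proof. reflexivity. Qed.

(** The prefactor is sinc (beta - l): at s = beta every factor of the product is 1, so no other
    value is possible. *)
Theorem corollary10 (s : C) (l : R) (hl : l <> 0) (beta : C)
  (hbeta : forall k : Z, k <> 0%Z -> beta <> (RtoC l + RtoC (IZR k * PI))%C) :
  exists P : C,
    is_infprod
      (fun k : nat =>
         1 - ((s - RtoC l) ^ 2 - (beta - RtoC l) ^ 2)
             / (RtoC (INR k) ^ 2 * RtoC PI ^ 2 - (beta - RtoC l) ^ 2))%C P
    /\ sinc (s - RtoC l)%C = (sinc (beta - RtoC l) * P)%C.
Proof.
set (w := (s - RtoC l)%C).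
assert (HPC : RtoC PI <> 0%C) by (apply RtoC_neq_0, PI_neq0).
assert (Hk : forall n, RtoC (INR (S n)) <> 0%C) by (intros n; apply RtoC_neq_0, not_0_INR; lia).
(* The denominator factors as (k pi - b)(k pi + b) with b = beta - l; the hypothesis at k and at -k
   excludes the two zeros. *)
assert (Hden : forall n,
  (RtoC (INR (S n)) ^ 2 * RtoC PI ^ 2 - (beta - RtoC l) ^ 2)%C <> 0%C).
{ intros n E.
  replace (_ - _)%C with ((RtoC (INR (S n)) * RtoC PI - (beta - RtoC l))
    * (RtoC (INR (S n)) * RtoC PI + (beta - RtoC l)))%C in E by ring.
  revert E; apply Cmult_neq_0; intros E.
  - apply (hbeta (Z.of_nat (S n))); [lia|].
    rewrite <- INR_IZR_INZ, RtoC_mult.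
    replace beta with (beta + 0)%C by ring; rewrite <- E; ring.
  - apply (hbeta (- Z.of_nat (S n))%Z); [lia|].
    rewrite opp_IZR, <- INR_IZR_INZ, RtoC_mult, RtoC_opp.
    replace beta with (beta - 0)%C by ring; rewrite <- E; ring. }
set (b := (beta - RtoC l)%C) in *.
assert (Hb : forall n, sinc_prod b n <> 0%C).
{ induction n as [|n IH]; [exact C1_nz|].
  apply Cmult_neq_0; [exact IH|].
  intros E; apply (Hden n).
  replace (_ - _)%C with ((1 - b ^ 2 / (RtoC (INR (S n)) ^ 2 * RtoC PI ^ 2))
    * (RtoC (INR (S n)) ^ 2 * RtoC PI ^ 2))%C by (field; auto).
  rewrite E; ring. }
exists (sinc w / sinc b)%C; split.
- apply is_infprod_sinc_quotient; [assumption|].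
  (* Factor by factor, 1 - (w^2 - b^2) / (k^2 pi^2 - b^2) equals (k^2 pi^2 - w^2) / (k^2 pi^2 -
     b^2), so multiplying by 1 - b^2 / (k^2 pi^2) leaves 1 - w^2 / (k^2 pi^2). *)
  induction n as [|n IH]; [apply Cmult_1_l|].
  rewrite Cprod_succ, !sinc_prod_succ, <- IH.
  field; repeat split; auto.
  rewrite Cpow_mult_l; apply Hden.
- field; now apply sinc_neq_0.
Qed.
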